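(* Let $Sys=(V,I,T)$ be a Boolean transition system and $P$ a safety property. The Forward CAR framework described in the context, run on $Sys$ and $P$ (with any choices of the partial assignments, minimal unsatisfiable cores and indices $k$ it uses), terminates, and its output is correct: it returns ''unsafe'' if and only if $Sys$ is unsafe for $P$, and ''safe'' if and only if $Sys$ is safe for $P$.
   Context: A Boolean transition system is $Sys=(V,I,T)$: $V$ a finite set of Boolean variables, states are assignments in $2^V$, $I$ a formula over $V$ (initial states), $T$ a formula over $V\cup V'$ ($V'$ a primed copy) with $(s_1,s_2)\in T$ iff $s_1\cup s_2'\models T$. Formulas over $V$ are identified with their sets of states; $\psi(x)$ and $\psi'(x')$ denote a formula and its primed copy. $R(X)=\{s'\mid (s,s')\in T, s\in X\}$, $R^{-1}(X)=\{s\mid(s,s')\in T, s'\in X\}$. $Sys$ is safe for $P$ if every state reachable (via a finite path of transitions, possibly of length zero) from an initial state satisfies $P$, and unsafe otherwise. A cube is a conjunction of literals, a clause a disjunction. For a satisfiable CNF formula $\phi$ over $V\cup V'$, a partial assignment is a set of literals $A^p$ contained in some satisfying assignment such that every full assignment extending $A^p$ satisfies $\phi$; $pa(\phi)|_x$ denotes the cube consisting of the literals over $V$ of such a partial assignment. For an unsatisfiable CNF formula $\phi=\psi\wedge c'$ where the cube $c'$ is viewed as a set of unit clauses, a minimal unsatisfiable core is a subset $C$ of the clauses that is unsatisfiable while every proper subset is satisfiable; $muc(\phi)|_{c'}$ denotes the cube formed by the unit clauses of $c'$ lying in such a core, taken unprimed. The framework maintains frames $F_0,F_1,\ldots$ (CNF,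 sets of clauses) and $B_0,B_1,\ldots$ (DNF, sets of cubes), with $S(F)=\bigcup_m F_m$ and $S(B)=\bigcup_m B_m$ (as state sets, always referring to the current frames). Forward CAR: (1) set $B_0=\neg P$, $F_0=I$. (2) If $F_0\cap B_0\neq\emptyset$ or $R(F_0)\cap B_0\neq\emptyset$, return unsafe. (3) For $i=1,2,\ldots$: (a) set $F_i:=P$; (b) while $S(F)\cap R^{-1}(S(B))\neq\emptyset$: (i) let $j$ be the minimal index such that $F_j\cap R^{-1}(B_k)\neq\emptyset$ for some $k\geq0$ (and fix such $k$); (ii) if $j=0$ return unsafe; (iii) let $c_1=pa(F_j(x)\wedge T(x,x')\wedge B_k'(x'))|_x$; (iv) add the cube $c_1$ to $B_{k+1}$ (creating $B_{k+1}=\{c_1\}$ if it does not exist); (v) let $\phi=F_{j-1}(x)\wedge T(x,x')\wedge c_1'(x')$; (vi) if $\phi$ is satisfiable, let $c_2=pa(\phi)|_x$ and add $c_2$ to $B_{k+2}$ (creating it if needed); (vii) if $\phi$ is unsatisfiable, let $c_2=muc(\phi)|_{c_1'}$ and add the clause $\neg c_2$ to $F_j$. (c) If there is $0\leq j\leq i$ with $F_j\subseteq\bigcup_{0\leq m\leq j-1}F_m$, return safe. (d) Continue with $i+1$. *)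

(* Defs.v *)
From mathcomp Require Import all_boot.
From Stdlib Require Export Relation_Operators.

Set Implicit Arguments.
Unset Strict Implicit.
Unset Printing Implicit Defensive.

Inductive formula (X : Type) : Type :=
| Var of X
| Bot
| Neg of formula X
| And of formula X & formula X
| Or of formula X & formula X.

Arguments Bot {X}.

Notation assignment X := {ffun X -> bool} (only parsing).

(* (x, true) is the literal x and (x, false) is its negation.  A set of literals
   is read conjunctively as a cube and disjunctively as a clause. *)
Notation literal X := (X * bool)%type (only parsing).
Notation cube X := {set literal X} (only parsing).
Notation clause X := {set literal X} (only parsing).
Notation cnf X := {set clause X} (only parsing).
Notation dnf X := {set cube X} (only parsing).

Section Propositional.
Variable X : finType.

Local Notation assignment := (assignment X).
Local Notation literal := (literal X).
Local Notation cube := (cube X).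
Local Notation clause := (clause X).
Local Notation cnf := (cnf X).
Local Notation dnf := (dnf X).

Fixpoint eval (a : assignment) (f : formula X) : bool :=
  match f with
  | Var x => a x
  | Bot => false
  | Neg f1 => ~~ eval a f1
  | And f1 f2 => eval a f1 && eval a f2
  | Or f1 f2 => eval a f1 || eval a f2
  end.

Definition models (f : formula X) : {set assignment} := [set a | eval a f].

Definition lit_holds (a : assignment) (l : literal) : bool := a l.1 == l.2.

(* Equivalently: the set of literals c is contained in the full assignment a. *)
Definition cube_holds (a : assignment) (c : cube) : bool :=
  [forall l in c, lit_holds a l].
Definition clause_holds (a : assignment) (c : clause) : bool :=
  [exists l in c, lit_holds a l].

Definition cnf_models (F : cnf) : {set assignment} :=
  [set a | [forall c in F, clause_holds a c]].
Definition dnf_models (B : dnf) : {set assignment} :=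
  [set a | [exists c in B, cube_holds a c]].

Definition satisfiable (F : cnf) : Prop := cnf_models F != set0.

(* Maps a clause to the cube of its negation, and a cube to the clause of its
   negation. *)
Definition negate (c : {set literal}) : {set literal} :=
  [set (l.1, ~~ l.2) | l in c].

(* De Morgan: the negation of a CNF, as a DNF. *)
Definition negate_cnf (F : cnf) : dnf := [set negate c | c in F].

Definition partial_assignment (phi : {set assignment}) (A : {set literal}) : Prop :=
  (exists2 a, a \in phi & cube_holds a A) /\
  (forall a, cube_holds a A -> a \in phi).

Definition minimal_unsat_core (phi C : cnf) : Prop :=
  [/\ C \subset phi,
      ~ satisfiable C &
      forall D : cnf, D \proper C -> satisfiable D].

End Propositional.

(* Over V + V, inl v is the variable v and inr v is its primed copy v'. *)
Record transition_system (V : finType) := TransitionSystem {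
  init : formula V;
  trans : formula (V + V)%type
}.

Section Car.
Variable V : finType.

Local Notation state := (assignment V).

Definition join (s1 s2 : state) : assignment (V + V)%type :=
  [ffun x => match x with inl v => s1 v | inr v => s2 v end].

Definition cur_lit (l : literal V) : literal (V + V)%type := (inl l.1, l.2).
Definition next_lit (l : literal V) : literal (V + V)%type := (inr l.1, l.2).

Definition cur_frame (F : {set {set literal V}}) : {set {set literal (V + V)%type}} :=
  [set cur_lit @: (c : {set literal V}) | c in F].
Definition next_frame (F : {set {set literal V}}) : {set {set literal (V + V)%type}} :=
  [set next_lit @: (c : {set literal V}) | c in F].

(* The primed cube c', as a set of unit clauses. *)
Definition next_units (c : cube V) : cnf (V + V)%type :=
  [set [set next_lit l] | l in c].

Definition restrict_cur (A : {set literal (V + V)%type}) : cube V :=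
  [set l | cur_lit l \in A].

Definition restrict_units (c : cube V) (C : cnf (V + V)%type) : cube V :=
  [set l in c | [set next_lit l] \in C].

Variable Sys : transition_system V.

Definition step_rel : rel state := fun s1 s2 => eval (join s1 s2) (trans Sys).

Definition successors (A : {set state}) : {set state} :=
  [set s' | [exists s in A, step_rel s s']].
Definition predecessors (A : {set state}) : {set state} :=
  [set s | [exists s' in A, step_rel s s']].

Definition safe (P : formula V) : Prop :=
  forall s0 s : state, s0 \in models (init Sys) -> connect step_rel s0 s ->
    s \in models P.
Definition unsafe (P : formula V) : Prop := ~ safe P.

Inductive verdict := Safe | Unsafe.

(* [Search F B] is the state of the algorithm at the head of the while loop, with
   F = [:: F_0; ...; F_i] (so that i is the last index of F) and
   B = [:: B_0; B_1; ...] the frames B_k created so far. *)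
Inductive config :=
| Start
| Search of seq (cnf V) & seq (dnf V)
| Return of verdict.

Definition frame (F : seq {set {set literal V}}) (j : nat) : {set {set literal V}} :=
  nth set0 F j.

Definition add_to (F : seq {set {set literal V}}) (j : nat) (c : {set literal V}) :
    seq {set {set literal V}} :=
  set_nth set0 F j (c |: frame F j).

Definition SF (F : seq (cnf V)) : {set state} := \bigcup_(G <- F) cnf_models G.
Definition SB (B : seq (dnf V)) : {set state} := \bigcup_(D <- B) dnf_models D.

Definition loop_condition (F : seq (cnf V)) (B : seq (dnf V)) : Prop :=
  SF F :&: predecessors (SB B) != set0.

Definition meets (F : seq (cnf V)) (B : seq (dnf V)) (j k : nat) : Prop :=
  [/\ j < size F, k < size B &
      cnf_models (frame F j) :&: predecessors (dnf_models (frame B k)) != set0].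

Definition minimal_meet (F : seq (cnf V)) (B : seq (dnf V)) (j k : nat) : Prop :=
  meets F B j k /\ (forall j' k', meets F B j' k' -> j <= j').

Definition covered (F : seq (cnf V)) : Prop :=
  exists2 j, j < size F &
    cnf_models (frame F j) \subset \bigcup_(m < j) cnf_models (frame F m).

(* CNFs representing the initial states, the transition relation and the
   property; minimal unsatisfiable cores depend on the chosen clauses. *)
Variables (I : cnf V) (T : cnf (V + V)%type) (P : cnf V).

(* F_j(x) /\ T(x,x') /\ D'(x') *)
Definition dnf_query (Fj : cnf V) (D : dnf V) : {set assignment (V + V)%type} :=
  cnf_models (cur_frame Fj) :&: cnf_models T :&: dnf_models (next_frame D).

(* F_j(x) /\ T(x,x') /\ c'(x') *)
Definition cube_query (Fj : cnf V) (c : cube V) : cnf (V + V)%type :=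
  cur_frame Fj :|: T :|: next_units c.

Definition initially_bad : Prop :=
  let B0 := dnf_models (negate_cnf P) in
  cnf_models I :&: B0 != set0 \/ successors (cnf_models I) :&: B0 != set0.

Inductive car_step : config -> config -> Prop :=
| StartUnsafe :
    initially_bad -> car_step Start (Return Unsafe)
| StartSearch :
    ~ initially_bad -> car_step Start (Search [:: I; P] [:: negate_cnf P])
| LoopUnsafe F B k :
    loop_condition F B -> minimal_meet F B 0 k ->
    car_step (Search F B) (Return Unsafe)
| LoopExtend F B j k A1 A2 :
    loop_condition F B -> minimal_meet F B j.+1 k ->
    partial_assignment (dnf_query (frame F j.+1) (frame B k)) A1 ->
    let c1 := restrict_cur A1 in
    let phi := cube_query (frame F j) c1 in
    satisfiable phi ->
    partial_assignment (cnf_models phi) A2 ->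
    let c2 := restrict_cur A2 in
    car_step (Search F B) (Search F (add_to (add_to B k.+1 c1) k.+2 c2))
| LoopBlock F B j k A1 C :
    loop_condition F B -> minimal_meet F B j.+1 k ->
    partial_assignment (dnf_query (frame F j.+1) (frame B k)) A1 ->
    let c1 := restrict_cur A1 in
    let phi := cube_query (frame F j) c1 in
    ~ satisfiable phi ->
    minimal_unsat_core phi C ->
    let c2 := restrict_units c1 C in
    car_step (Search F B) (Search (add_to F j.+1 (negate c2)) (add_to B k.+1 c1))
| LoopSafe F B :
    ~ loop_condition F B -> covered F -> car_step (Search F B) (Return Safe)
| LoopNext F B :
    ~ loop_condition F B -> ~ covered F ->
    car_step (Search F B) (Search (rcons F P) B).

Definition reachable : config -> Prop := clos_refl_trans config car_step Start.

(* Every maximal execution is finite and ends with a verdict. *)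
Definition terminates : Prop :=
  (forall run : nat -> config, run 0 = Start ->
     ~ (forall n, car_step (run n) (run n.+1))) /\
  (forall c, reachable c -> (exists r, c = Return r) \/ (exists c', car_step c c')).

Definition returns (r : verdict) : Prop := reachable (Return r).

End Car.

(* Main.v *)
Require Import Defs.
From mathcomp Require Import all_boot.

(* Correctness: F_0 = I, every F_j implies P, R(F_j) is contained in F_(j+1), and
   every state of every B_k reaches a state violating P.  Hence a transition from
   F_0 into some B_k witnesses unsafety, and if F_j is covered by the earlier frames,
   their union is an inductive invariant contained in P.

   Termination: while no frame is opened, each iteration enlarges S(B) or shrinks
   the set of states of some frame.  When phi is satisfiable, the cube c_1 contains
   a successor of a state of F_(j-1), which by minimality of j was not in S(B); when
   phi is unsatisfiable, the states of c_1 leave F_j.  The number of frames is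
   bounded by the number of states, since a frame is opened only if every F_j has a
   state that no earlier frame has. *)

Set Implicit Arguments.
Unset Strict Implicit.
Unset Printing Implicit Defensive.

(** * Semantics of cubes, clauses, CNFs and DNFs *)

Section Propositional.
Variable X : finType.
Implicit Types (a : assignment X) (c A : {set literal X}) (F G : cnf X) (D : dnf X).

Lemma cube_holdsP a c :
  reflect (forall l, l \in c -> lit_holds a l) (cube_holds a c).
Proof. exact: (iffP forall_inP). Qed.

Lemma clause_holdsP a c :
  reflect (exists2 l, l \in c & lit_holds a l) (clause_holds a c).
Proof. exact: (iffP exists_inP). Qed.

Lemma cnf_modelsP F a :
  reflect (forall c, c \in F -> clause_holds a c) (a \in cnf_models F).
Proof. rewrite inE; exact: (iffP forall_inP). Qed.

Lemma dnf_modelsP D a :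
  reflect (exists2 c, c \in D & cube_holds a c) (a \in dnf_models D).
Proof. rewrite inE; exact: (iffP exists_inP). Qed.

Lemma cube_holds_subset a c1 c2 :
  c1 \subset c2 -> cube_holds a c2 -> cube_holds a c1.
Proof.
by move=> /subsetP sub12 /cube_holdsP holds2; apply/cube_holdsP => l /sub12 /holds2.
Qed.

Lemma cnf_modelsU F G : cnf_models (F :|: G) = cnf_models F :&: cnf_models G.
Proof.
apply/setP => a; rewrite in_setI; apply/cnf_modelsP/andP => [holds|[]].
  by split; apply/cnf_modelsP => c cFG; apply: holds; rewrite inE cFG ?orbT.
by move=> /cnf_modelsP holdsF /cnf_modelsP holdsG c /setUP[/holdsF|/holdsG].
Qed.

Lemma cnf_models_add c F a :
  (a \in cnf_models (c |: F)) = clause_holds a c && (a \in cnf_models F).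
Proof.
rewrite cnf_modelsU in_setI; congr (_ && _).
by apply/cnf_modelsP/idP => [/(_ c)|holds d /set1P-> //]; rewrite set11; apply.
Qed.

Lemma dnf_models_add c D a :
  (a \in dnf_models (c |: D)) = cube_holds a c || (a \in dnf_models D).
Proof.
apply/dnf_modelsP/orP => [[d /setU1P[->|dD] ad]|[ac|/dnf_modelsP[d dD ad]]].
- by left.
- by right; apply/dnf_modelsP; exists d.
- by exists c; rewrite ?setU11.
- by exists d; rewrite // inE dD orbT.
Qed.

Lemma dnf_models0 : dnf_models (set0 : dnf X) = set0.
Proof. by apply/setP => a; rewrite in_set0; apply/dnf_modelsP => -[c]; rewrite inE. Qed.

Lemma clause_holds_negate a c : clause_holds a (negate c) = ~~ cube_holds a c.
Proof.
apply/clause_holdsP/idP => [[_ /imsetP[l lc ->]]|].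
  rewrite /lit_holds /= => /eqP al.
  by apply/cube_holdsP => /(_ l lc); rewrite /lit_holds al; case: l.2.
rewrite negb_forall_in => /existsP[l /andP[lc al]].
exists (l.1, ~~ l.2); first exact: imset_f.
by move: al; rewrite /lit_holds /=; case: (a l.1); case: l.2.
Qed.

(** [negate] is an involution, so this is [clause_holds_negate] applied to [negate c]. *)
Lemma cube_holds_negate a c : cube_holds a (negate c) = ~~ clause_holds a c.
Proof.
rewrite -[LHS]negbK -clause_holds_negate; congr (~~ clause_holds a _).
rewrite /negate -imset_comp -[RHS]imset_id.
by apply: eq_imset => -[x b] /=; rewrite negbK.
Qed.

Lemma dnf_models_negate F : dnf_models (negate_cnf F) = ~: cnf_models F.
Proof.
apply/setP => a; rewrite in_setC; apply/dnf_modelsP/idP => [[_ /imsetP[c cF ->]]|].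
  by rewrite cube_holds_negate; apply: contra => /cnf_modelsP/(_ c cF).
rewrite inE negb_forall_in => /existsP[c /andP[cF ac]].
by exists (negate c); [apply: imset_f | rewrite cube_holds_negate].
Qed.

(** All the literals of a satisfying assignment form a partial assignment, since its only full
    extension is that assignment. *)
Lemma partial_assignment_exists (phi : {set assignment X}) :
  phi != set0 -> exists A, partial_assignment phi A.
Proof.
case/set0Pn => a a_phi; exists [set l | lit_holds a l]; split.
  by exists a => //; apply/cube_holdsP => l; rewrite inE.
move=> b /cube_holdsP holds; suff -> : b = a by [].
apply/ffunP => x; apply/eqP.
by have := holds (x, a x); rewrite inE /lit_holds /= eqxx; apply.
Qed.

Lemma minimal_unsat_core_exists F :
  ~ satisfiable F -> exists C, minimal_unsat_core F C.
Proof.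
move=> unsatF; pose p := [pred D : cnf X | cnf_models D == set0].
have pF : p F by apply/negbNE/negP.
have [C /minsetP[/= pC minC] CF] := minset_exists pF.
exists C; split=> // [|D ltDC]; first by rewrite /satisfiable pC.
apply/negP => pD; have eqDC := minC D pD (proper_sub ltDC).
by move: ltDC; rewrite eqDC properxx.
Qed.

End Propositional.

(** * Assignments over [V + V] as pairs of states *)

Section Car.
Variable V : finType.
Local Notation state := (assignment V).
Implicit Types (s : state) (c : {set literal V}) (F B : seq {set {set literal V}}).

Definition cur_part (a : assignment (V + V)%type) : state := [ffun v => a (inl v)].
Definition next_part (a : assignment (V + V)%type) : state := [ffun v => a (inr v)].

Lemma join_parts a : join (cur_part a) (next_part a) = a.
Proof. by apply/ffunP => -[v|v]; rewrite !ffunE. Qed.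

Lemma lit_holds_cur s s' l : lit_holds (join s s') (cur_lit l) = lit_holds s l.
Proof. by rewrite /lit_holds ffunE. Qed.

Lemma lit_holds_next s s' l : lit_holds (join s s') (next_lit l) = lit_holds s' l.
Proof. by rewrite /lit_holds ffunE. Qed.

Lemma cnf_models_cur s s' (F : cnf V) :
  (join s s' \in cnf_models (cur_frame F)) = (s \in cnf_models F).
Proof.
have clauseE c : clause_holds (join s s') (@cur_lit V @: c) = clause_holds s c.
  apply/clause_holdsP/clause_holdsP => [[_ /imsetP[l lc ->]]|[l lc sl]].
    by rewrite lit_holds_cur; exists l.
  by exists (cur_lit l); rewrite ?lit_holds_cur // imset_f.
apply/cnf_modelsP/cnf_modelsP => [holds c cF|holds _ /imsetP[c cF ->]].
  by rewrite -clauseE; apply/holds/imset_f.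
by rewrite clauseE; apply: holds.
Qed.

Lemma dnf_models_next s s' (D : dnf V) :
  (join s s' \in dnf_models (next_frame D)) = (s' \in dnf_models D).
Proof.
have cubeE c : cube_holds (join s s') (@next_lit V @: c) = cube_holds s' c.
  apply/cube_holdsP/cube_holdsP => [holds l lc|holds _ /imsetP[l lc ->]].
    by rewrite -(lit_holds_next s); apply/holds/imset_f.
  by rewrite lit_holds_next; apply: holds.
apply/dnf_modelsP/dnf_modelsP => [[_ /imsetP[c cD ->]]|[c cD s'c]].
  by rewrite cubeE; exists c.
by exists (@next_lit V @: c); rewrite ?cubeE // imset_f.
Qed.

Lemma clause_holds_next_unit s s' l :
  clause_holds (join s s') [set next_lit l] = lit_holds s' l.
Proof.
apply/clause_holdsP/idP => [[_ /set1P->]|]; rewrite -(lit_holds_next s) //.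
by exists (next_lit l); rewrite ?set11.
Qed.

Lemma cnf_models_next_units s s' c :
  (join s s' \in cnf_models (next_units c)) = cube_holds s' c.
Proof.
apply/cnf_modelsP/cube_holdsP => [holds l lc|holds _ /imsetP[l lc ->]].
  by rewrite -(clause_holds_next_unit s); apply/holds/imset_f.
by rewrite clause_holds_next_unit; apply: holds.
Qed.

(** The next state can be taken from the assignment witnessing [A]: it satisfies the primed literals
    of [A] whatever [s] is, so the joined assignment extends [A]. *)
Lemma restrict_cur_holds (phi : {set assignment (V + V)%type}) A s :
  partial_assignment phi A -> cube_holds s (restrict_cur A) ->
  exists s', join s s' \in phi.
Proof.
case=> -[a a_phi /cube_holdsP aA] phiA /cube_holdsP sA.
exists (next_part a); apply/phiA/cube_holdsP => -[[v|v] b] lA.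
  by have := sA (v, b); rewrite inE /lit_holds ffunE => /(_ lA).
by have := aA _ lA; rewrite /lit_holds ffunE /= ffunE.
Qed.

(** Supplies the state whose removal makes a blocking step strictly decreasing. *)
Lemma restrict_cur_sat (phi : {set assignment (V + V)%type}) A :
  partial_assignment phi A -> exists s, cube_holds s (restrict_cur A).
Proof.
case=> -[a _ /cube_holdsP aA] _; exists (cur_part a).
by apply/cube_holdsP => l; rewrite inE => /aA; rewrite /lit_holds ffunE.
Qed.

(** * Frames and the effect of [add_to] *)

Lemma frame_add_to F j c m :
  frame (add_to F j c) m = if m == j then c |: frame F j else frame F m.
Proof. by rewrite /frame /add_to nth_set_nth /=. Qed.

Lemma size_add_to F j c : j < size F -> size (add_to F j c) = size F.
Proof. by move=> ltjF; rewrite size_set_nth (maxn_idPr ltjF). Qed.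

Lemma SFP F s :
  reflect (exists2 j, j < size F & s \in cnf_models (frame F j)) (s \in SF F).
Proof.
rewrite /SF (big_nth set0) big_mkord.
apply: (iffP bigcupP) => [[j _ sj]|[j ltjF sj]]; first by exists j.
by exists (Ordinal ltjF).
Qed.

(** No bound on [k] is required: the default [set0] is a DNF without models. As a CNF it holds
    everywhere, hence the bound in [SFP]. *)
Lemma SBP B s :
  reflect (exists k, s \in dnf_models (frame B k)) (s \in SB B).
Proof.
rewrite /SB (big_nth set0) big_mkord.
apply: (iffP bigcupP) => [[k _ sk]|[k sk]]; first by exists k.
have [ltkB|leBk] := ltnP k (size B); first by exists (Ordinal ltkB).
by move: sk; rewrite /frame nth_default // dnf_models0 inE.
Qed.

Lemma dnf_frame_size B k s : s \in dnf_models (frame B k) -> k < size B.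
Proof.
rewrite ltnNge; apply: contraTN => leBk.
by rewrite /frame nth_default // dnf_models0 inE.
Qed.

Lemma dnf_frame_add B j c k s :
  s \in dnf_models (frame (add_to B j c) k) ->
  (k = j /\ cube_holds s c) \/ s \in dnf_models (frame B k).
Proof.
rewrite frame_add_to; case: eqP => [->|_]; last by right.
by rewrite dnf_models_add => /orP[]; [left|right].
Qed.

Lemma cnf_frame_add F j c m :
  cnf_models (frame (add_to F j c) m) \subset cnf_models (frame F m).
Proof.
rewrite frame_add_to; case: eqP => [->|//].
by apply/subsetP => s; rewrite cnf_models_add => /andP[].
Qed.

Lemma SB_add_sub B k c : SB B \subset SB (add_to B k c).
Proof.
apply/subsetP => s /SBP[m sm]; apply/SBP; exists m.
by rewrite frame_add_to; case: eqP sm => [->|//]; rewrite dnf_models_add orbC => ->.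
Qed.

Lemma SB_add_mem B k c s : cube_holds s c -> s \in SB (add_to B k c).
Proof. by move=> sc; apply/SBP; exists k; rewrite frame_add_to eqxx dnf_models_add sc. Qed.

(** * The loop condition and minimal indices *)

Variable Sys : transition_system V.

Lemma predecessorsP (A : {set state}) s :
  reflect (exists2 s', s' \in A & step_rel Sys s s') (s \in predecessors Sys A).
Proof. rewrite inE; exact: (iffP exists_inP). Qed.

Lemma successorsP (A : {set state}) s :
  reflect (exists2 s0, s0 \in A & step_rel Sys s0 s) (s \in successors Sys A).
Proof. rewrite inE; exact: (iffP exists_inP). Qed.

Lemma meetsP F B j k :
  meets Sys F B j k <->
  j < size F /\ exists s s', [/\ s \in cnf_models (frame F j), step_rel Sys s s' &
                                 s' \in dnf_models (frame B k)].
Proof.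
split=> [[ltj ltk /set0Pn[s /setIP[sF /predecessorsP[s' s'B ss']]]]|].
  by split=> //; exists s, s'.
case=> ltj [s [s' [sF ss' s'B]]]; split=> //; first exact: dnf_frame_size s'B.
by apply/set0Pn; exists s; rewrite inE sF; apply/predecessorsP; exists s'.
Qed.

Lemma loop_conditionP F B :
  loop_condition Sys F B <-> exists j k, meets Sys F B j k.
Proof.
split=> [/set0Pn[s /setIP[/SFP[j ltj sF] /predecessorsP[s' /SBP[k s'B] ss']]]|].
  by exists j, k; apply/meetsP; split=> //; exists s, s'.
case=> j [k /meetsP[ltj [s [s' [sF ss' s'B]]]]]; apply/set0Pn; exists s.
rewrite inE; apply/andP; split; first by apply/SFP; exists j.
by apply/predecessorsP; exists s' => //; apply/SBP; exists k.
Qed.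

Lemma minimal_meet_exists F B :
  loop_condition Sys F B -> exists j k, minimal_meet Sys F B j k.
Proof.
(* A Boolean form of being met by some frame of [B], so that [ex_minn] yields the least index. *)
pose p j := (j < size F) && [exists k : 'I_(size B),
  cnf_models (frame F j) :&: predecessors Sys (dnf_models (frame B k)) != set0].
have pP j k : meets Sys F B j k -> p j.
  by case=> ltj ltk meet; rewrite /p ltj; apply/existsP; exists (Ordinal ltk).
move/loop_conditionP => [j0 [k0 meet0]].
have ex_p : exists j, p j by exists j0; apply: pP meet0.
case: (ex_minnP ex_p) => j /andP[ltj /existsP[k meet]] minj.
by exists j, k; split=> // j' k' /pP; apply: minj.
Qed.

Lemma loop_condition_dec F B : {loop_condition Sys F B} + {~ loop_condition Sys F B}.
Proof. exact: decP idP. Qed.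

Lemma coveredP F :
  reflect (covered F)
    [exists j : 'I_(size F),
      cnf_models (frame F j) \subset \bigcup_(m < j) cnf_models (frame F m)].
Proof.
apply: (iffP existsP) => [[j sub]|[j ltj sub]]; first by exists j.
by exists (Ordinal ltj).
Qed.

(** * The two queries and the cubes extracted from them *)

Variables (I : cnf V) (T : cnf (V + V)%type) (P : cnf V).
Hypothesis hT : cnf_models T = models (trans Sys).

Lemma trans_models s s' : (join s s' \in cnf_models T) = step_rel Sys s s'.
Proof. by rewrite hT inE. Qed.

Lemma dnf_queryE G D s s' :
  (join s s' \in dnf_query T G D) =
  [&& s \in cnf_models G, step_rel Sys s s' & s' \in dnf_models D].
Proof. by rewrite !in_setI cnf_models_cur trans_models dnf_models_next andbA. Qed.

Lemma cube_queryE G c s s' :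
  (join s s' \in cnf_models (cube_query T G c)) =
  [&& s \in cnf_models G, step_rel Sys s s' & cube_holds s' c].
Proof.
by rewrite !cnf_modelsU !in_setI cnf_models_cur trans_models cnf_models_next_units andbA.
Qed.

Lemma cube_query_sat G c :
  satisfiable (cube_query T G c) <->
  exists s s', [/\ s \in cnf_models G, step_rel Sys s s' & cube_holds s' c].
Proof.
split=> [/set0Pn[a]|[s [s' [sG ss' s'c]]]].
  rewrite -(join_parts a) cube_queryE => /and3P[sG ss' s'c].
  by exists (cur_part a), (next_part a).
by apply/set0Pn; exists (join s s'); rewrite cube_queryE sG ss'.
Qed.

Lemma dnf_query_restrict G D A s :
  partial_assignment (dnf_query T G D) A -> cube_holds s (restrict_cur A) ->
  s \in cnf_models G /\ exists2 s', step_rel Sys s s' & s' \in dnf_models D.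
Proof.
move=> pA sA; have [s'] := restrict_cur_holds pA sA.
by rewrite dnf_queryE => /and3P[? ? ?]; split=> //; exists s'.
Qed.

Lemma cube_query_restrict G c A s :
  partial_assignment (cnf_models (cube_query T G c)) A -> cube_holds s (restrict_cur A) ->
  exists2 s', step_rel Sys s s' & cube_holds s' c.
Proof.
move=> pA sA; have [s'] := restrict_cur_holds pA sA.
by rewrite cube_queryE => /and3P[? ? ?]; exists s'.
Qed.

(** The core clauses from [G] and [T] hold at [join s s']. If [s'] also satisfied the literals kept
    by the core, the whole core would be satisfiable. *)
Lemma restrict_units_blocks G c C s s' :
  minimal_unsat_core (cube_query T G c) C ->
  s \in cnf_models G -> step_rel Sys s s' -> ~~ cube_holds s' (restrict_units c C).
Proof.
case=> /subsetP subC unsatC _ sG ss'; apply/negP => /cube_holdsP s'c.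
apply: unsatC; apply/set0Pn; exists (join s s'); apply/cnf_modelsP => d dC.
have /setUP[/setUP[d_cur|d_T]|d_unit] := subC d dC.
- by move: sG; rewrite -(cnf_models_cur s s') => /cnf_modelsP; apply.
- by move: ss'; rewrite -trans_models => /cnf_modelsP; apply.
case/imsetP: d_unit dC => l lc -> lC.
by rewrite clause_holds_next_unit; apply: s'c; rewrite inE lc.
Qed.

(** * Termination: progress and a decreasing weight *)

Lemma car_step_progress F B :
  exists c' : config V, car_step Sys I T P (Search F B) c'.
Proof.
have [loop|noloop] := loop_condition_dec F B; last first.
  have [cov|ncov] := coveredP F; first by exists (Return V Safe); apply: LoopSafe.
  by exists (Search (rcons F P) B); apply: LoopNext.
have [[|j] [k meet]] := minimal_meet_exists loop.
  by exists (Return V Unsafe); apply: LoopUnsafe loop meet.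
have /meetsP[_ [s [s' [sF ss' s'B]]]] := meet.1.
have [|A1 pA1] := @partial_assignment_exists _ (dnf_query T (frame F j.+1) (frame B k)).
  by apply/set0Pn; exists (join s s'); rewrite dnf_queryE sF ss'.
have [sat|unsat] := boolP (cnf_models (cube_query T (frame F j) (restrict_cur A1)) != set0).
  have [A2 pA2] := partial_assignment_exists sat.
  by eexists; apply: LoopExtend loop meet pA1 sat pA2.
have [C coreC] := minimal_unsat_core_exists (elimN idP unsat).
by eexists; apply: LoopBlock loop meet pA1 (elimN idP unsat) coreC.
Qed.

Definition frames_weight F := \sum_(j < size F) #|cnf_models (frame F j)|.

Lemma frames_weight_rcons F :
  frames_weight (rcons F P) <= frames_weight F + #|{: state}|.
Proof.
rewrite /frames_weight size_rcons big_ord_recr /= leq_add ?max_card //.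
by apply/leq_sum => j _; rewrite /frame nth_rcons ltn_ord.
Qed.

Lemma frames_weight_add F j c s :
  j < size F -> s \in cnf_models (frame F j) -> ~~ clause_holds s c ->
  frames_weight (add_to F j c) < frames_weight F.
Proof.
move=> ltj sF nsc; rewrite /frames_weight size_add_to //.
rewrite (bigD1 (Ordinal ltj)) //= [ltnRHS](bigD1 (Ordinal ltj)) //= -addSn.
apply: leq_add; last by apply: leq_sum => m _; apply/subset_leq_card/cnf_frame_add.
apply/proper_card/properP; split; first exact: cnf_frame_add.
by exists s => //; rewrite frame_add_to eqxx cnf_models_add (negPf nsc).
Qed.

(** Each uncovered frame brings a new state, so the union of the first [n] frames has at least [n]
    states. *)
Lemma uncovered_size F : ~ covered F -> size F <= #|{: state}|.
Proof.
move=> ncov; suff: forall n, n <= size F ->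
    n <= #|\bigcup_(m < n) cnf_models (frame F m)|.
  by move/(_ _ (leqnn _)) => /leq_trans; apply; apply: max_card.
elim=> // n IHn ltn; apply: leq_ltn_trans (IHn (ltnW ltn)) _.
apply/proper_card; rewrite big_ord_recr /=; apply/properP; split; first exact: subsetUl.
have /subsetPn[s sn nsn] : ~~ (cnf_models (frame F n) \subset
    \bigcup_(m < n) cnf_models (frame F m)).
  by apply/negP => sub; apply: ncov; exists n.
by exists s; rewrite // inE sn orbT.
Qed.

(* Opening a frame adds at most #|state| to [frames_weight], and pays for it with
   one of the #|state|.+1 - size F remaining openings. *)
Definition search_weight F B :=
  (#|{: state}|.+1 - size F) * #|{: state}|.+1 + (#|~: SB B| + frames_weight F).

(** The added constants make the steps out of [Start] and into [Return] decrease as well. *)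
Definition weight (c : config V) :=
  match c with
  | Start => (search_weight [:: I; P] [:: negate_cnf P]).+2
  | Search F B => (search_weight F B).+1
  | Return _ => 0
  end.

Lemma SBC_add_le B k c : #|~: SB (add_to B k c)| <= #|~: SB B|.
Proof. by apply/subset_leq_card; rewrite setCS SB_add_sub. Qed.

Lemma car_step_weight (c c' : config V) : car_step Sys I T P c c' -> weight c' < weight c.
Proof.
case=> {c c'} //=.
- move=> F B j k A1 A2 _ [[ltj _ _] min_j] pA1 /cube_query_sat[s [s' [sF ss' s'c1]]] _.
  rewrite ltnS /search_weight ltn_add2l ltn_add2r.
  apply: leq_ltn_trans (SBC_add_le _ _ _) _; apply/proper_card/properP.
  split; first by rewrite setCS SB_add_sub.
  exists s'; rewrite in_setC ?negbK ?SB_add_mem //.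
  apply/negP => /SBP[k' s'B].
  (* If [s'] were already in [SB B], frame [j] would meet [B], against the minimality of [j.+1]. *)
  have /min_j : meets Sys F B j k' by apply/meetsP; split; [apply: ltnW|exists s, s'].
  by rewrite ltnn.
- move=> F B j k A1 C _ [[ltj _ _] _] pA1 _ coreC.
  have [s sA1] := restrict_cur_sat pA1.
  have [sF _] := dnf_query_restrict pA1 sA1.
  rewrite ltnS /search_weight size_add_to // ltn_add2l -addnS leq_add ?SBC_add_le //.
  apply: frames_weight_add ltj sF _; rewrite clause_holds_negate negbK.
  (* The core keeps only literals of [c1], so the state [s] of [c1] falsifies the new clause. *)
  by apply: cube_holds_subset sA1; apply/subsetP => l; rewrite inE => /andP[].
- move=> F B _ /uncovered_size leF.
  (* One factor of the product is released, worth the number of states plus one, while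
     [frames_weight] grows by at most the number of states. *)
  rewrite ltnS /search_weight size_rcons subSS (subSn leF) mulSn -addnA.
  rewrite [ltnRHS]addnCA ltn_add2l [ltnRHS]addnCA ltn_add2l addSn ltnS addnC.
  exact: frames_weight_rcons.
Qed.

Lemma no_infinite_run (run : nat -> config V) :
  ~ (forall n, car_step Sys I T P (run n) (run n.+1)).
Proof.
move=> steps.
have bound n : weight (run n) + n <= weight (run 0).
  elim: n => [|n IHn]; first by rewrite addn0.
  by apply: leq_trans IHn; rewrite addnS -addSn leq_add2r car_step_weight.
by have := bound (weight (run 0)).+1; rewrite addnS ltnNge leq_addl.
Qed.

Lemma car_terminates : terminates Sys I T P.
Proof.
split=> [run _|c _]; first exact: no_infinite_run.
case: c => [|F B|r]; [right|right; exact: car_step_progress|by left; exists r].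
have [b1|b1] := boolP (cnf_models I :&: dnf_models (negate_cnf P) != set0).
  by exists (Return V Unsafe); apply: StartUnsafe; left.
have [b2|b2] := boolP (successors Sys (cnf_models I) :&: dnf_models (negate_cnf P) != set0).
  by exists (Return V Unsafe); apply: StartUnsafe; right.
by eexists; apply: StartSearch; case; apply/negP.
Qed.

(** * Correctness: the invariant of the search *)

Definition system_safe :=
  forall s0 s, s0 \in cnf_models I -> connect (step_rel Sys) s0 s -> s \in cnf_models P.

Definition reaches_bad s :=
  exists2 s', connect (step_rel Sys) s s' & s' \notin cnf_models P.

(** The bound [0 < size F] excludes an empty [F] matching [I] through the default value of [frame].
    Frames of [B] out of range have no states, so the last condition can range over all [k]. *)
Definition search_invariant F B : Prop :=
  [/\ 0 < size F /\ frame F 0 = I, frame B 0 = negate_cnf P,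
      forall j, j < size F -> cnf_models (frame F j) \subset cnf_models P,
      forall j, j.+1 < size F ->
        successors Sys (cnf_models (frame F j)) \subset cnf_models (frame F j.+1) &
      forall k s, s \in dnf_models (frame B k) -> reaches_bad s].

Definition invariant (c : config V) : Prop :=
  match c with
  | Start => True
  | Search F B => search_invariant F B
  | Return Safe => system_safe
  | Return Unsafe => ~ system_safe
  end.

Lemma reaches_bad_step s s' : step_rel Sys s s' -> reaches_bad s' -> reaches_bad s.
Proof. by move=> ss' [t s't tP]; exists t => //; apply: connect_trans (connect1 ss') s't. Qed.

Lemma reaches_bad_unsafe s : s \in cnf_models I -> reaches_bad s -> ~ system_safe.
Proof. by move=> sI [t st /negP tP] safe; apply: tP; apply: safe st. Qed.

Lemma initially_bad_unsafe : initially_bad Sys I P -> ~ system_safe.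
Proof.
rewrite /initially_bad dnf_models_negate => -[]/set0Pn[s /setIP[sI]]; rewrite in_setC => sP.
  by apply: reaches_bad_unsafe sI _; exists s.
case/successorsP: sI => s0 s0I s0s.
by apply: reaches_bad_unsafe s0I _; exists s => //; apply: connect1.
Qed.

(** These inclusions are the base case of the invariant, where the frames are [I] and [P]. *)
Lemma not_initially_bad_sub :
  ~ initially_bad Sys I P -> cnf_models I \subset cnf_models P /\
    successors Sys (cnf_models I) \subset cnf_models P.
Proof.
rewrite /initially_bad dnf_models_negate => nbad.
by split; rewrite -[_ \subset _]negbK -setD_eq0 setDE; apply/negP => bad;
  apply: nbad; [left|right].
Qed.

(* The union of the frames before the covered one is closed under successors. *)
Lemma covered_safe F B : search_invariant F B -> covered F -> system_safe.
Proof.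
case=> [[_ F0] _ subP succF _] [j ltj sub] s0 s s0I /connectP[p path_p ->].
set U := \bigcup_(m < j) _ in sub.
have UP t : t \in U -> t \in cnf_models P.
  by case/bigcupP => m _; apply/subsetP/subP/(ltn_trans _ ltj).
have Usucc t t' : t \in U -> step_rel Sys t t' -> t' \in U.
  case/bigcupP => m _ tm tt'.
  have t'm : t' \in cnf_models (frame F m.+1).
    apply: (subsetP (succF m (leq_ltn_trans (ltn_ord m) ltj))).
    by apply/successorsP; exists t.
  case: (ltngtP m.+1 j) (ltn_ord m) => // [ltm|eqm] _.
    by apply/bigcupP; exists (Ordinal ltm).
  (* The successor may land in frame [j] itself, which coverage puts back inside [U]. *)
  by apply: (subsetP sub); rewrite -eqm.
have s0U : s0 \in U.
  (* For [j = 0] the union is empty, and coverage of frame 0 leaves no initial state. *)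
  rewrite -F0 in s0I; case: (posnP j) => [j0|j_gt0].
    by apply: (subsetP sub); rewrite j0.
  by apply/bigcupP; exists (Ordinal j_gt0).
apply: UP; elim: p s0 s0U path_p {s0I} => //= t p IHp s0 s0U /andP[s0t].
exact/IHp/(Usucc s0).
Qed.

Lemma car_step_invariant (c c' : config V) :
  car_step Sys I T P c c' -> invariant c -> invariant c'.
Proof.
case=> {c c'} //=.
- by move=> bad _; apply: initially_bad_unsafe.
- move=> /not_initially_bad_sub[IP succP] _; split=> //=.
  + by case=> [|[|]].
  + by case.
  + case=> [|[|k]] s; rewrite /frame /= ?dnf_models0 ?in_set0 //.
    by rewrite dnf_models_negate in_setC => sP; exists s.
- move=> F B k _ [/meetsP[_ [s [s' [sF ss' s'B]]]] _] [[_ F0] _ _ _ badB].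
  apply: reaches_bad_unsafe (reaches_bad_step ss' (badB _ _ s'B)).
  by rewrite -F0.
- move=> F B j k A1 A2 _ _ pA1 _ pA2 [F0 B0 subP succF badB].
  split=> //; first by rewrite !frame_add_to.
  have bad1 s : cube_holds s (restrict_cur A1) -> reaches_bad s.
    case/(dnf_query_restrict pA1) => _ [s' ss' /badB]; exact: reaches_bad_step.
  (* A state of [B] now comes from [c2], from [c1] or from an old frame. States of [c2] step into
     [c1], and those of [c1] into the old [B_k]. *)
  move=> m s /dnf_frame_add[[_]|/dnf_frame_add[[_ /bad1 //]|/badB //]].
  case/(cube_query_restrict pA2) => s' ss' /bad1; exact: reaches_bad_step.
- move=> F B j k A1 C _ [[ltj _ _] _] pA1 _ coreC [[F_gt0 F0] B0 subP succF badB].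
  split; rewrite ?size_add_to ?frame_add_to //.
  + by move=> m ltm; apply: subset_trans (subP m ltm); apply: cnf_frame_add.
  + move=> m ltm; apply/subsetP => s' /successorsP[s sF ss'].
    have {}sF := subsetP (cnf_frame_add _ _ _ _) _ sF.
    have s'F : s' \in cnf_models (frame F m.+1).
      by apply: (subsetP (succF m ltm)); apply/successorsP; exists s.
    (* Only frame [j.+1] got a new clause; successors of frame [j] satisfy it because they avoid the
       blocked cube. *)
    rewrite frame_add_to; case: eqP => [[eqm]|//].
    rewrite cnf_models_add clause_holds_negate -eqm s'F andbT.
    by apply: restrict_units_blocks coreC _ ss'; rewrite -eqm.
  + move=> m s /dnf_frame_add[[_]|/badB //].
    case/(dnf_query_restrict pA1) => _ [s' ss' /badB]; exact: reaches_bad_step.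
- by move=> F B _ cov inv; apply: covered_safe inv cov.
- move=> F B noloop _ [[F_gt0 F0] B0 subP succF badB].
  rewrite /search_invariant size_rcons.
  have frame_old j : j < size F -> frame (rcons F P) j = frame F j.
    by rewrite /frame nth_rcons => ->.
  have frame_last : frame (rcons F P) (size F) = P by rewrite /frame nth_rcons ltnn eqxx.
  split=> //; first by rewrite frame_old.
    move=> j; rewrite ltnS leq_eqVlt => /predU1P[->|ltj]; first by rewrite frame_last.
    by rewrite frame_old // subP.
  move=> j; rewrite ltnS => lej; rewrite frame_old //.
  move: lej; rewrite leq_eqVlt => /predU1P[eqj|ltj]; last by rewrite frame_old ?succF.
  rewrite eqj frame_last; apply/subsetP => s' /successorsP[s sF ss'].
  (* A successor of the last frame violating [P] lies in [B_0], so the loop would not have ended. *)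
  apply/negPn/negP => s'P; apply: noloop; apply/loop_conditionP; exists j, 0.
  apply/meetsP; rewrite -eqj leqnn; split=> //; exists s, s'; split=> //.
  by rewrite B0 dnf_models_negate in_setC.
Qed.

Lemma reachable_invariant (c : config V) : reachable Sys I T P c -> invariant c.
Proof.
suff: forall c0 : config V, clos_refl_trans _ (car_step Sys I T P) c0 c -> invariant c0 -> invariant c.
  by move=> inv /inv; apply.
move=> c0; elim=> // {c0 c} [c c'|c1 c2 c3 _ IH1 _ IH2 /IH1/IH2 //].
exact: car_step_invariant.
Qed.

End Car.

Theorem theorem3 (V : finType) (Sys : transition_system V) (P : formula V)
    (I_cnf P_cnf : cnf V) (T_cnf : cnf (V + V)%type)
    (hI : cnf_models I_cnf = models (init Sys))
    (hT : cnf_models T_cnf = models (trans Sys))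
    (hP : cnf_models P_cnf = models P) :
  terminates Sys I_cnf T_cnf P_cnf /\
  (forall r : verdict, returns Sys I_cnf T_cnf P_cnf r ->
     (r = Unsafe <-> unsafe Sys P) /\ (r = Safe <-> safe Sys P)).
Proof.
split=> [|r /(reachable_invariant hT)]; first exact: car_terminates.
(* Replacing the CNFs by the formulas they represent turns [system_safe] into [safe Sys P]. *)
rewrite /= /system_safe hI hP -/(safe Sys P) /unsafe.
by case: r => ?; split; split.
Qed.
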